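(* There is a universal constant $c_0>0$ such that the following holds. For any $0<\delta\le L$, $n\ge 3$, $D>0$ and $0<\varepsilon\le\delta D^2/(12\sqrt2)$, there exist dimensions $d_x,d_y$, $L$-smooth and convex-concave functions $f_1,\dots,f_n:\mathbb{R}^{d_x}\times\mathbb{R}^{d_y}\to\mathbb{R}$ with $\delta$-second-order similarity, and a closed convex set $\mathcal{Z}=\mathcal{X}\times\mathcal{Y}$ with diameter $D$, such that any DFO algorithm that finds an approximate solution $z=(x,y)$ of $\min_{x\in\mathcal{X}}\max_{y\in\mathcal{Y}}\frac1n\sum_{i=1}^n f_i(x,y)$ with $\mathbb{E}[\operatorname{Gap}(z)]\le\varepsilon$ needs at least $c_0\,\delta D^2/\varepsilon$ communication rounds (i.e. $\Omega(\delta D^2/\varepsilon)$ rounds).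
   Context: $f=\frac1n\sum_{i=1}^n f_i$; $\operatorname{Gap}(x,y)=\max_{y'\in\mathcal{Y}}f(x,y')-\min_{x'\in\mathcal{X}}f(x',y)$. $F_i(z)=[\nabla_x f_i;-\nabla_y f_i]$; ''$L$-smooth'': $\|F_i(z_1)-F_i(z_2)\|\le L\|z_1-z_2\|$ for all $i,z_1,z_2$. ''Convex-concave'': convex in $x$, concave in $y$. ''$\delta$-second-order similarity'': the $f_i$ are twice differentiable and $\|\nabla^2 f_i(x,y)-\nabla^2 f(x,y)\|\le\delta$ for all $i,x,y$ (spectral norm). Diameter $D$ of $\mathcal{Z}$: $\|z_1-z_2\|\le D$ for all $z_1,z_2\in\mathcal{Z}$. Distributed first-order oracle (DFO) algorithm: node $1$ is the server (holding $f_1$), nodes $2,\dots,n$ are clients (node $i$ holding $f_i$). Each node $i$ has local memories $\mathcal{M}_i^x,\mathcal{M}_i^y$, initialized as $\{0\}$, updated as follows. - Communication from clients to server: in one communication round, sample uniformly and independently a batch $\mathcal{S}$ of any size $b$ of nodes; the server may add points $x_1'\in\operatorname{span}\{x_1,\bigcup_{i\in\mathcal{S}}x_i\}$, $y_1'\in\operatorname{span}\{y_1,\bigcup_{i\in\mathcal{S}}y_i\}$ with $x_i\in\mathcal{M}_i^x$, $y_i\in\mathcal{M}_i^y$ to its memories; this costs $b$ communication complexity. Batch size $n$ means all clients send. - Communication from server to clients: in one communication round, sample uniformly and independently a batch $\mathcal{S}$ of any size $b$; each client $i\in\mathcal{S}$ may add $x_i'\in\operatorname{span}\{x_1,x_i\}$,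 $y_i'\in\operatorname{span}\{y_1,y_i\}$ with $x_i\in\mathcal{M}_i^x,y_i\in\mathcal{M}_i^y$ to its memories; this costs $b$ communication complexity. - Local computations: node $i$ may add $x_i'\in\operatorname{span}\{x',\nabla_x f_i(x'',y'')\}$, $y_i'\in\operatorname{span}\{y',\nabla_y f_i(x'',y'')\}$ for $x',x''\in\mathcal{M}_i^x$, $y',y''\in\mathcal{M}_i^y$ to its memories; local gradient calls count the applications of $\nabla_x,\nabla_y$ to any $f_i$. The final output is some $\hat x\in\mathcal{M}_1^x$, $\hat y\in\mathcal{M}_1^y$. Expectation is over the algorithm's randomness. *)

(* Defs.v *)
From HB Require Import structures.
From Stdlib Require Import Relation_Operators.
From mathcomp Require Import all_boot all_order all_algebra.
From mathcomp Require Import all_classical all_reals all_analysis.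

Set Implicit Arguments.
Unset Strict Implicit.
Unset Printing Implicit Defensive.

Import Order.TTheory GRing.Theory Num.Theory.
Import numFieldNormedType.Exports.

Local Open Scope classical_set_scope.
Local Open Scope ring_scope.

Section Euclidean.
Context {R : realType}.

(* The canonical norm `|v| of 'rV[R]_k is the sup norm, so the Euclidean norm
   is introduced separately. *)
Definition enorm k (v : 'rV[R]_k) : R := Num.sqrt (\sum_i v 0 i ^+ 2).

Definition spectral_norm k (A : 'M[R]_k) : R :=
  sup [set enorm (v *m A) | v in [set v : 'rV[R]_k | enorm v <= 1]].

Definition grad k (g : 'rV[R]_k -> R) (z : 'rV[R]_k) : 'rV[R]_k :=
  \row_j 'D_(delta_mx 0 j) (g : 'rV[R]_k -> R^o) z.

Definition hess k (g : 'rV[R]_k -> R) (z : 'rV[R]_k) : 'M[R]_k :=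
  'J (grad g) z.

Definition twice_differentiable k (g : 'rV[R]_k -> R) : Prop :=
  forall z, differentiable (g : 'rV[R]_k -> R^o) z /\
            differentiable (grad g) z.

End Euclidean.

Section Minimax.
Context {R : realType} {dx dy : nat}.
Implicit Types (f : 'rV[R]_dx -> 'rV[R]_dy -> R).

(* [f] as a function of the single variable z = (x, y) in R^(dx + dy). *)
Definition joint f (z : 'rV[R]_(dx + dy)) : R := f (lsubmx z) (rsubmx z).

Definition gradx f x y : 'rV[R]_dx := grad (f^~ y) x.
Definition grady f x y : 'rV[R]_dy := grad (f x) y.

Definition saddle_op f x y : 'rV[R]_(dx + dy) :=
  row_mx (gradx f x y) (- grady f x y).

Definition smooth (L : R) f : Prop :=
  (forall z, differentiable (joint f : _ -> R^o) z) /\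
  forall x1 y1 x2 y2,
    enorm (saddle_op f x1 y1 - saddle_op f x2 y2)
    <= L * enorm (row_mx x1 y1 - row_mx x2 y2).

Definition convex_concave f : Prop :=
  (forall y, @convex_function R 'rV[R]_dx setT (fun x => f x y)) /\
  (forall x, @convex_function R 'rV[R]_dy setT (fun y => - f x y)).

Definition average n (f : 'I_n -> 'rV[R]_dx -> 'rV[R]_dy -> R) :
    'rV[R]_dx -> 'rV[R]_dy -> R :=
  fun x y => n%:R^-1 * \sum_(i < n) f i x y.

Definition second_order_similar (delta : R) n
    (f : 'I_n -> 'rV[R]_dx -> 'rV[R]_dy -> R) : Prop :=
  (forall i, twice_differentiable (joint (f i))) /\
  forall i z,
    spectral_norm (hess (joint (f i)) z - hess (joint (average f)) z) <= delta.

Definition diameter_le (D : R) (Z : set ('rV[R]_dx * 'rV[R]_dy)) : Prop :=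
  forall z1 z2, Z z1 -> Z z2 ->
    enorm (row_mx z1.1 z1.2 - row_mx z2.1 z2.2) <= D.

Definition gap (X : set 'rV[R]_dx) (Y : set 'rV[R]_dy) f x y : R :=
  sup [set f x y' | y' in Y] - inf [set f x' y | x' in X].

End Minimax.

(* Direction of a communication round. *)
Inductive direction := ToServer | ToClients.

Section DFO.
Context {R : realType} {dx dy : nat}.
(* There are m.+1 nodes; ord0 is the server, the others are the clients. *)
Context {m : nat}.
Local Notation node := 'I_m.+1.
Local Notation batch_set := {set 'I_m.+1}.

Record memory := Memory {
  memx : node -> set 'rV[R]_dx;
  memy : node -> set 'rV[R]_dy }.

Definition memory0 : memory :=
  Memory (fun=> [set 0]) (fun=> [set 0]).

(* A step may add any set of points, each of which is admissible. *)
Definition grows (T : Type) (adm M M' : set T) : Prop :=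
  M `<=` M' /\ M' `<=` M `|` adm.

Definition unchanged (i : node) (M M' : memory) : Prop :=
  memx M' i = memx M i /\ memy M' i = memy M i.

(* span {x_1, U_(i in S) x_i} for some choice of x_i in the memory of node i *)
Definition server_adm d (S : batch_set) (M : node -> set 'rV[R]_d) :
    set 'rV[R]_d :=
  [set v | exists xs : node -> 'rV[R]_d, (forall i, M i (xs i)) /\
     v \in <<xs ord0 :: [seq xs i | i in S]>>%VS].

Definition client_adm d (i : node) (M : node -> set 'rV[R]_d) :
    set 'rV[R]_d :=
  [set v | exists x1 xi, [/\ M ord0 x1, M i xi & v \in <<[:: x1; xi]>>%VS]].

Definition comm_step (dir : direction) (S : batch_set) (M M' : memory) : Prop :=
  match dir with
  | ToServer =>
      [/\ grows (server_adm S (memx M)) (memx M ord0) (memx M' ord0),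
          grows (server_adm S (memy M)) (memy M ord0) (memy M' ord0)
        & forall i, i != ord0 -> unchanged i M M']
  | ToClients =>
      forall i, if (i != ord0) && (i \in S) then
          grows (client_adm i (memx M)) (memx M i) (memx M' i) /\
          grows (client_adm i (memy M)) (memy M i) (memy M' i)
        else unchanged i M M'
  end.

Variable f : node -> 'rV[R]_dx -> 'rV[R]_dy -> R.

Definition local_admx (i : node) (M : memory) : set 'rV[R]_dx :=
  [set v | exists x1 x2 y2, [/\ memx M i x1, memx M i x2, memy M i y2
     & v \in <<[:: x1; gradx (f i) x2 y2]>>%VS]].

Definition local_admy (i : node) (M : memory) : set 'rV[R]_dy :=
  [set v | exists y1 x2 y2, [/\ memy M i y1, memx M i x2, memy M i y2
     & v \in <<[:: y1; grady (f i) x2 y2]>>%VS]].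

Definition local_step (M M' : memory) : Prop :=
  exists i, [/\ grows (local_admx i M) (memx M i) (memx M' i),
                grows (local_admy i M) (memy M i) (memy M' i)
              & forall j, j != i -> unchanged j M M'].

Definition local_computation : memory -> memory -> Prop :=
  clos_refl_trans memory local_step.

(* All decisions are functions of a private random seed and of the list of the
   batches sampled in the previous rounds.
   - [alg_mem u h] is the memory after the rounds with batches [h] and the local
     computations that follow them;
   - [alg_next u h] is the direction and the batch size of the next round, or
     [None] if the algorithm stops;
   - [alg_out u h] is the output if the algorithm stops after [h]. *)
Record algorithm (Seed : Type) := Algorithm {
  alg_mem : Seed -> seq batch_set -> memory;
  alg_next : Seed -> seq batch_set -> option (direction * nat);
  alg_out : Seed -> seq batch_set -> 'rV[R]_dx * 'rV[R]_dy }.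

Definition dfo Seed (A : algorithm Seed) : Prop :=
  [/\ forall u, local_computation memory0 (alg_mem A u [::]),
      forall u h dir (S : batch_set), alg_next A u h = Some (dir, #|S|) ->
        exists2 M, comm_step dir S (alg_mem A u h) M
                 & local_computation M (alg_mem A u (rcons h S))
    & forall u h, alg_next A u h = None ->
        memx (alg_mem A u h) ord0 (alg_out A u h).1 /\
        memy (alg_mem A u h) ord0 (alg_out A u h).2].

Definition history (Omega : Type) (batch : nat -> Omega -> batch_set)
    (t : nat) (w : Omega) : seq batch_set :=
  mkseq (batch^~ w) t.

Definition output Seed (A : algorithm Seed) (Omega : Type) (U : Omega -> Seed)
    (batch : nat -> Omega -> batch_set) (N : Omega -> nat) (w : Omega) :
    'rV[R]_dx * 'rV[R]_dy :=
  alg_out A (U w) (history batch (N w) w).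

(* [U] is the seed, [batch t] the batch of the round of index [t] (from 0) and
   [N] the number of communication rounds before [A] stops.  The last clause
   says that, conditionally on the seed and the past batches, each batch is
   uniform among the sets of nodes of the requested size. *)
Definition execution dS dO (Seed : measurableType dS)
    (Omega : measurableType dO) (P : probability Omega R) (A : algorithm Seed)
    (U : Omega -> Seed) (batch : nat -> Omega -> batch_set)
    (N : Omega -> nat) : Prop :=
  [/\ [/\ measurable_fun [set: Omega] U,
          measurable_fun [set: Omega] N,
          forall t B, measurable [set w | batch t w = B]
        & forall h c, measurable [set u | alg_next A u h = c]],
      forall w t, (t < N w)%N -> exists dir,
        alg_next A (U w) (history batch t w) = Some (dir, #|batch t w|),
      forall w, alg_next A (U w) (history batch (N w) w) = None
    & forall (V : set Seed) (h : seq batch_set) (dir : direction)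
             (B : batch_set), measurable V ->
        let past := [set w | [/\ V (U w), history batch (size h) w = h,
          (size h < N w)%N & alg_next A (U w) h = Some (dir, #|B|)]] in
        P (past `&` [set w | batch (size h) w = B])
        = ((('C(m.+1, #|B|))%:R^-1)%:E * P past)%E].

End DFO.

(* Main.v *)
(* On R^K x R^K consider the bilinear function
     f(x, y) = a * sum_(j < K) y_j (x_j - x_(j-1)),  with x_(-1) := s,
   where a = delta / 3.  The nodes of odd index hold the terms in y_j x_(j-1),
   the nodes of even index the terms in y_j x_j, with weights making the average
   equal to f.  Along the chain y_0, x_0, y_1, x_1, ... consecutive coordinates
   are discovered by nodes of different parities, hence one round brings at most
   one new coordinate, and x_(K-1) stays 0 when there are fewer than K rounds.

   Let r = D / (2 sqrt 2), s = 2 r / sqrt K, let Y be the ball of radius r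
   around 0 and X the one around (s/2, ..., s/2), which contains both 0 and
   x* = (s, ..., s).  Since f(x*, .) = 0, every gap is nonnegative, and testing
   with the constant vector y' = - r / sqrt K shows, by telescoping, that the
   gap is at least 2 a r^2 / K = delta D^2 / (12 K) when x_(K-1) = 0.  For
   K = floor(delta D^2 / (12 sqrt 2 eps)) this is at least sqrt 2 * eps, hence
   G / (sqrt 2 * eps) + N / K >= 1 pointwise, and E[N] >= (1 - 1 / sqrt 2) K. *)

Require Import Defs.
From mathcomp Require Import all_boot all_order all_algebra.
From mathcomp Require Import all_classical all_reals all_analysis.
From mathcomp Require Import measurable_realfun ring lra zify.
Import Order.TTheory GRing.Theory Num.Theory.
Import numFieldNormedType.Exports.
Local Open Scope classical_set_scope.
Local Open Scope ring_scope.

Set Implicit Arguments.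
Unset Strict Implicit.
Unset Printing Implicit Defensive.

(** * Euclidean inner product of row vectors *)

Section Dot.
Context {R : realType}.

Definition dot k (u v : 'rV[R]_k) : R := (u *m v^T) 0 0.

Lemma dotE k (u v : 'rV[R]_k) : dot u v = \sum_i u 0 i * v 0 i.
Proof. by rewrite /dot mxE; apply: eq_bigr => i _; rewrite mxE. Qed.

Lemma dotDl k (u v w : 'rV[R]_k) : dot (u + v) w = dot u w + dot v w.
Proof. by rewrite /dot mulmxDl mxE. Qed.

Lemma dotDr k (u v w : 'rV[R]_k) : dot w (u + v) = dot w u + dot w v.
Proof. by rewrite /dot linearD mulmxDr mxE. Qed.

Lemma dotZl k a (u v : 'rV[R]_k) : dot (a *: u) v = a * dot u v.
Proof. by rewrite /dot -scalemxAl mxE. Qed.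

Lemma dotZr k a (u v : 'rV[R]_k) : dot u (a *: v) = a * dot u v.
Proof. by rewrite /dot linearZ -scalemxAr mxE. Qed.

Lemma dotNN k (u : 'rV[R]_k) : dot (- u) (- u) = dot u u.
Proof. by rewrite -scaleN1r dotZl dotZr !mulN1r opprK. Qed.

Lemma dot0l k (u : 'rV[R]_k) : dot 0 u = 0.
Proof. by rewrite /dot mul0mx mxE. Qed.

Lemma dot0r k (u : 'rV[R]_k) : dot u 0 = 0.
Proof. by rewrite /dot trmx0 mulmx0 mxE. Qed.

Lemma dotC k (u v : 'rV[R]_k) : dot u v = dot v u.
Proof. by rewrite !dotE; apply: eq_bigr => i _; rewrite mulrC. Qed.

Lemma dot_mulmx k l (x : 'rV[R]_k) (B : 'M[R]_(k, l)) y :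
  dot (x *m B) y = dot x (y *m B^T).
Proof. by rewrite /dot trmx_mul trmxK mulmxA. Qed.

Lemma dot_row_mx k l (x x' : 'rV[R]_k) (y y' : 'rV[R]_l) :
  dot (row_mx x y) (row_mx x' y') = dot x x' + dot y y'.
Proof. by rewrite /dot tr_row_mx mul_row_col mxE. Qed.

Lemma dot_delta k (u : 'rV[R]_k) j : dot (delta_mx 0 j) u = u 0 j.
Proof. by rewrite /dot -rowE !mxE. Qed.

Lemma dot_ge0 k (u : 'rV[R]_k) : 0 <= dot u u.
Proof. by rewrite dotE sumr_ge0// => i _; rewrite -expr2 sqr_ge0. Qed.

Lemma enormE k (u : 'rV[R]_k) : enorm u = Num.sqrt (dot u u).
Proof. by rewrite /enorm dotE; under eq_bigr do rewrite expr2. Qed.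

Lemma enorm_le k (u : 'rV[R]_k) r :
  0 <= r -> (enorm u <= r) = (dot u u <= r ^+ 2).
Proof.
by move=> r0; rewrite enormE -{1}(ger0_norm r0) -sqrtr_sqr ler_sqrt// sqr_ge0.
Qed.

End Dot.

(** * Gradients and Jacobians of quadratic and affine maps *)

Section Calculus.
Context {R : realType}.

(** The expansion is exact, so the difference quotient at [h != 0] is [l + h * q], which tends to
    [l]. *)
Lemma derive_quadratic (V : normedModType R) (g : V -> R^o) z v (l q : R) :
  (forall t : R, g (t *: v + z) = g z + t * l + t ^+ 2 * q) -> 'D_v g z = l.
Proof.
move=> gE; apply/cvg_lim => //.
apply: (@cvg_trans _ ((fun h : R => l + h * q) @ 0^')).
  apply: near_eq_cvg; near=> h => /=.
  have h0 : h != 0 by near: h; exact: nbhs_dnbhs_neq.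
  rewrite gE /GRing.scale /=; field; exact: h0.
suff : (fun h : R => l + h * q) @ 0^' --> l + 0 * q by rewrite mul0r addr0.
apply: cvg_within_filter; apply: cvgD; first exact: cvg_cst.
by apply: cvgM; [exact: cvg_id|exact: cvg_cst].
Unshelve. all: by end_near. Qed.

Lemma grad_quadratic k (g : 'rV[R]_k -> R) z w (q : 'rV[R]_k -> R) :
  (forall v t, g (t *: v + z) = g z + t * dot v w + t ^+ 2 * q v) ->
  grad g z = w.
Proof.
move=> gE; apply/rowP => j; rewrite mxE.
by rewrite (derive_quadratic (gE (delta_mx 0 j))) dot_delta.
Qed.

Lemma differentiable_mulmxr k l (H : 'M[R]_(k, l)) z :
  differentiable (mulmxr H : 'rV[R]_k -> 'rV[R]_l) z.
Proof.
have -> : (mulmxr H : 'rV[R]_k -> 'rV[R]_l)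
    = \sum_(i < k) (fun v : 'rV[R]_k => v 0 i *: row i H).
  by apply/funext => v; rewrite fct_sumE /= mulmx_sum_row.
by apply: differentiable_sum => i; exact/differentiableZl/differentiable_coord.
Qed.

Lemma is_diff_affine k l (H : 'M[R]_(k, l)) c (z : 'rV[R]_k) :
  is_diff z ((fun v => v *m H + c) : 'rV[R]_k -> 'rV[R]_l) (mulmxr H).
Proof.
have -> : (fun v : 'rV[R]_k => v *m H + c) = (mulmxr H : 'rV_k -> 'rV_l) + cst c.
  by apply/funext.
have Hc : continuous (mulmxr H : 'rV[R]_k -> 'rV[R]_l).
  by move=> v; apply: differentiable_continuous; exact: differentiable_mulmxr.
have Hd : is_diff z (mulmxr H : 'rV[R]_k -> 'rV[R]_l) (mulmxr H).
  apply: DiffDef; first exact: differentiable_mulmxr.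
  exact: (@diff_lin _ _ _ (mulmxr H)).
rewrite -[X in is_diff _ _ X]addr0; apply: is_diffD; exact: is_diff_cst.
Qed.

Lemma jacobian_affine k l (H : 'M[R]_(k, l)) c z :
  'J ((fun v => v *m H + c) : 'rV[R]_k -> 'rV[R]_l) z = H.
Proof.
apply/row_matrixP => i; rewrite !rowE /jacobian mul_rV_lin1.
by have [_ ->] := is_diff_affine H c z.
Qed.

End Calculus.

(** * Functions bilinear up to a linear term in [y]: derivatives, smoothness, convexity *)

Section Bilinear.
Context {R : realType} {dx dy : nat}.
Implicit Types (B : 'M[R]_(dx, dy)) (b : 'rV[R]_dy).

Definition bilin B b (x : 'rV[R]_dx) (y : 'rV[R]_dy) : R := dot (x *m B + b) y.

Lemma gradx_bilin B b x y : gradx (bilin B b) x y = y *m B^T.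
Proof.
apply: (@grad_quadratic _ _ _ _ _ (fun=> 0)) => v t.
rewrite /bilin mulmxDl -scalemxAl !dotDl dotZl dot_mulmx; ring.
Qed.

Lemma grady_bilin B b x y : grady (bilin B b) x y = x *m B + b.
Proof.
apply: (@grad_quadratic _ _ _ _ _ (fun=> 0)) => v t.
rewrite /bilin dotDr dotZr (dotC v); ring.
Qed.

(** Only the cross term of the increments in [x] and [y] is of second order. The joint gradient
    being affine, the Hessian is constant. *)
Lemma grad_joint_bilin B b :
  grad (joint (bilin B b)) = (fun z => z *m block_mx 0 B B^T 0 + row_mx 0 b).
Proof.
apply/funext => z; apply: (@grad_quadratic _ _ _ _ _
  (fun v => dot (lsubmx v *m B) (rsubmx v))) => v t.
rewrite /joint /bilin !linearD !linearZ /= -[in dot v _](hsubmxK v).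
rewrite -[in dot _ (z *m _ + _)](hsubmxK z) mul_row_block !mulmx0 add0r addr0.
rewrite add_row_mx addr0 dot_row_mx mulmxDl -scalemxAl -dot_mulmx.
rewrite !(dotDl, dotDr, dotZl, dotZr) (dotC (rsubmx v) (_ *m _)).
rewrite (dotC (rsubmx v) b); ring.
Qed.

Lemma hess_bilin B b z :
  hess (joint (bilin B b)) z = block_mx 0 B B^T 0.
Proof. by rewrite /hess grad_joint_bilin jacobian_affine. Qed.

Lemma differentiable_joint_bilin B b z :
  differentiable (joint (bilin B b) : _ -> R^o) z.
Proof.
have -> : joint (bilin B b) =
    \sum_(j < dy) ((fun z => (lsubmx z *m B + b) 0 j : R) *
                   (fun z => (rsubmx z) 0 j : R)).
  by apply/funext => u; rewrite /joint /bilin dotE fct_sumE.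
apply: differentiable_sum => j; apply: differentiableM.
  apply: (@differentiable_comp _ _ _ _ (fun z => lsubmx z *m B + b)
     (fun v : 'rV[R]_dy => v 0 j : R^o)); last exact: differentiable_coord.
  apply: (@differentiable_comp _ _ _ _ lsubmx (fun x => x *m B + b)).
    exact: differentiable_lsubmx.
  by have [] := is_diff_affine B b (lsubmx z).
apply: (@differentiable_comp _ _ _ _ rsubmx
     (fun v : 'rV[R]_dy => v 0 j : R^o)); last exact: differentiable_coord.
exact: differentiable_rsubmx.
Qed.

Lemma twice_differentiable_bilin B b : twice_differentiable (joint (bilin B b)).
Proof.
move=> z; split; first exact: differentiable_joint_bilin.
rewrite grad_joint_bilin.
by have [] := is_diff_affine (block_mx 0 B B^T 0) (row_mx 0 b) z.
Qed.

(** The function is affine in each variable, so both inequalities are equalities. *)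
Lemma convex_concave_bilin B b : convex_concave (bilin B b).
Proof.
split=> [y|x] t u v _ _; rewrite convRE -subr_ge0 le_eqVlt; apply/orP; left;
  apply/eqP; rewrite /bilin /conv /= ?mulmxDl -?scalemxAl ?onemE;
  rewrite !(dotDl, dotDr, dotZl, dotZr) /unstable.onem; ring.
Qed.

Lemma average_bilin m (B : 'I_m -> 'M[R]_(dx, dy)) (b : 'I_m -> 'rV[R]_dy) :
  average (fun i => bilin (B i) (b i))
  = bilin (m%:R^-1 *: \sum_i B i) (m%:R^-1 *: \sum_i b i).
Proof.
apply/funext => x; apply/funext => y.
rewrite /average /bilin -scalemxAr -scalerDr dotZl; congr (_ * _).
rewrite mulmx_sumr -big_split /=.
have dotD : {morph (fun u : 'rV_dy => dot u y) : u v / u + v}.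
  by move=> u v; exact: dotDl.
by rewrite (big_morph _ dotD (dot0l y)).
Qed.

(** For [0 <= c], an operator norm bound. It is required of [B] and [B^T] separately, which spares a
    proof that their norms agree. *)
Definition mx_bounded (c : R) B : Prop :=
  (forall x, dot (x *m B) (x *m B) <= c ^+ 2 * dot x x) /\
  (forall y, dot (y *m B^T) (y *m B^T) <= c ^+ 2 * dot y y).

(** The shift [b] cancels in differences, and the two halves of the saddle operator depend on [y]
    and [x] separately, so their squared bounds add up. *)
Lemma smooth_bilin c B b : 0 <= c -> mx_bounded c B -> smooth c (bilin B b).
Proof.
move=> c0 [Bx By]; split; first exact: differentiable_joint_bilin.
move=> x1 y1 x2 y2; rewrite /saddle_op !gradx_bilin !grady_bilin.
rewrite enorm_le ?mulr_ge0 ?enormE ?sqrtr_ge0// exprMn sqr_sqrtr ?dot_ge0//.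
rewrite !opp_row_mx !add_row_mx opprK -mulmxBl.
have -> : - (x1 *m B + b) + (x2 *m B + b) = - ((x1 - x2) *m B).
  by rewrite mulmxBl opprB opprD addrACA addNr addr0 addrC.
rewrite !dot_row_mx dotNN addrC mulrDr.
exact: lerD.
Qed.

Lemma spectral_norm_le k (A : 'M[R]_k) c : 0 <= c ->
  (forall v, dot (v *m A) (v *m A) <= c ^+ 2 * dot v v) -> spectral_norm A <= c.
Proof.
move=> c0 Ac; apply: ge_sup.
  by exists (enorm (0 *m A)), 0 => //=; rewrite enorm_le// dot0l sqr_ge0.
move=> _ [v /= v1 <-]; rewrite enorm_le// (le_trans (Ac v))//.
by rewrite ler_piMr ?sqr_ge0// -[leRHS](expr1n _ 2) -enorm_le.
Qed.

Lemma spectral_norm_block c B : 0 <= c -> mx_bounded c B ->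
  spectral_norm (block_mx 0 B B^T 0) <= c.
Proof.
move=> c0 [Bx By]; apply: spectral_norm_le => // v.
rewrite -(hsubmxK v) mul_row_block !mulmx0 add0r addr0 !dot_row_mx mulrDr addrC.
exact: lerD.
Qed.

End Bilinear.

(** * Euclidean balls, their products, and lower bounds on the gap *)

Section Balls.
Context {R : realType}.

Lemma dot_addr_le k (u v : 'rV[R]_k) :
  dot (u + v) (u + v) <= 2 * dot u u + 2 * dot v v.
Proof.
have := dot_ge0 (u - v).
rewrite -[- v]scaleN1r !(dotDl, dotDr, dotZl, dotZr) (dotC v u); lra.
Qed.

(** Follows from the nonnegative squares of [u + v] and [u - v]. It replaces Cauchy-Schwarz where
    only boundedness matters. *)
Lemma dot_young k (u v : 'rV[R]_k) : `|dot u v| <= dot u u + dot v v.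
Proof.
have := dot_ge0 (u - v); have := dot_ge0 (u + v).
rewrite -[- v]scaleN1r !(dotDl, dotDr, dotZl, dotZr) (dotC v u).
by move=> h1 h2; have := dot_ge0 u; have := dot_ge0 v; rewrite ler_norml; lra.
Qed.

Definition eball k (c : 'rV[R]_k) (r : R) : set 'rV[R]_k :=
  [set x | dot (x - c) (x - c) <= r ^+ 2].

Lemma dot_eball_bounded k (c : 'rV[R]_k) r u : exists M : R,
  forall v, eball c r v -> `|dot u v| <= M.
Proof.
exists (dot u u + (2 * r ^+ 2 + 2 * dot c c)) => v vc.
rewrite (le_trans (dot_young u v))// lerD2l.
have := dot_addr_le (v - c) c; rewrite subrK => /le_trans; apply.
by rewrite lerD2r ler_pM2l.
Qed.

Lemma closed_eball k (c : 'rV[R]_k) r : closed (eball c r).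
Proof.
have -> : eball c r = (fun x => dot (x - c) (x - c)) @^-1` [set y | y <= r ^+ 2].
  by [].
apply: preimage_closed; last exact: closed_le.
move=> x _; apply: differentiable_continuous.
have -> : (fun x : 'rV[R]_k => dot (x - c) (x - c) : R^o) =
    \sum_(j < k) ((fun x : 'rV[R]_k => (x 0 j : R) + - c 0 j) *
                  (fun x : 'rV[R]_k => (x 0 j : R) + - c 0 j)).
  apply/funext => z; rewrite dotE fct_sumE; apply: eq_bigr => j _.
  by rewrite !mxE.
apply: differentiable_sum => j.
by apply: differentiableM; apply: differentiableD => //;
  exact: differentiable_coord.
Qed.

(** With [u] and [v] taken relative to the centre, the squared norm of the combination is the
    combination of the squared norms minus [a * (1 - a) * dot (u - v) (u - v)]. *)
Lemma eball_conv k (c : 'rV[R]_k) r u v (t : {i01 R}) : eball c r u ->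
  eball c r v -> eball c r (t%:num *: u + unstable.onem t%:num *: v).
Proof.
rewrite /eball /= => uc vc.
have a0 : 0 <= t%:num by [].
have a1 : 0 <= 1 - t%:num by rewrite subr_ge0 le1.
move: (t%:num) a0 a1 => a a0 a1.
have -> : a *: u + unstable.onem a *: v - c = a *: (u - c) + (1 - a) *: (v - c).
  by apply/rowP => j; rewrite !mxE /unstable.onem; ring.
move: (u - c) (v - c) uc vc => {}u {}v uc vc.
have : 0 <= a * (1 - a) * dot (u - v) (u - v) by rewrite !mulr_ge0// dot_ge0.
have := ler_wpM2l a0 uc; have := ler_wpM2l a1 vc.
rewrite -[- v]scaleN1r !(dotDl, dotDr, dotZl, dotZr) (dotC v u).
by move: (dot u u) (dot u v) (dot v v) (r ^+ 2) => uu uv vv rr; lra.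
Qed.

Lemma convex_eballX k l (c : 'rV[R]_k) (c' : 'rV[R]_l) r :
  @convex_set R ('rV[R]_k * 'rV[R]_l)%type (eball c r `*` eball c' r).
Proof.
move=> u v t; rewrite !inE => -[u1 u2] [v1 v2].
by split; apply: eball_conv.
Qed.

Lemma closed_eballX k l (c : 'rV[R]_k) (c' : 'rV[R]_l) r :
  closed (eball c r `*` eball c' r).
Proof.
have -> : eball c r `*` eball c' r = fst @^-1` eball c r `&` snd @^-1` eball c' r.
  by [].
by apply: closedI; apply: preimage_closed; try exact: closed_eball;
  move=> x _; [exact: cvg_fst|exact: cvg_snd].
Qed.

Lemma diameter_eballX k l (c : 'rV[R]_k) (c' : 'rV[R]_l) r D :
  0 <= D -> 8 * r ^+ 2 <= D ^+ 2 -> diameter_le D (eball c r `*` eball c' r).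
Proof.
move=> D0 rD z1 z2 [x1 y1] [x2 y2].
rewrite enorm_le// opp_row_mx add_row_mx dot_row_mx.
have diff d (a u v : 'rV[R]_d) : eball a r u -> eball a r v ->
    dot (u - v) (u - v) <= 4 * r ^+ 2.
  rewrite /eball /= => ua va; have := dot_addr_le (u - a) (- (v - a)).
  rewrite dotNN opprB addrA subrK; lra.
have := diff _ _ _ _ x1 x2; have := diff _ _ _ _ y1 y2; lra.
Qed.

(** Any pair of test points bounds the gap from below, provided that the sets of values are bounded:
    otherwise [sup] and [inf] would return a default value. *)
Lemma gap_eball_ge dx dy (B : 'M[R]_(dx, dy)) b c c' r x y x' y' :
  eball c r x' -> eball c' r y' ->
  bilin B b x y' - bilin B b x' y
  <= gap (eball c r) (eball c' r) (bilin B b) x y.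
Proof.
move=> cx cy; apply: lerB.
  apply: ub_le_sup; last by exists y'.
  have [M HM] := dot_eball_bounded c' r (x *m B + b).
  by exists M => _ [v /HM vM <-]; rewrite (le_trans _ vM)// ler_norm.
apply: ge_inf; last by exists x'.
have [M HM] := dot_eball_bounded c r (y *m B^T).
exists (- M + dot b y) => _ [v /HM vM <-].
rewrite /bilin dotDl lerD2r dot_mulmx dotC.
by have := ler_norm (- dot (y *m B^T) v); rewrite normrN; lra.
Qed.

End Balls.

(** * The chain function, its operator norm and its gap *)

Section Chain.
Context {R : realType} {k : nat}.
Implicit Types (x y : 'rV[R]_k.+1) (p q s : R).

Definition shift_mx : 'M[R]_k.+1 := \matrix_(i, j) (j == i.+1 :> nat)%:R.

Lemma shift0 x : (x *m shift_mx) 0 ord0 = 0.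
Proof. by rewrite mxE big1// => i _; rewrite mxE mulr0. Qed.

Lemma shiftS x j :
  (x *m shift_mx) 0 (lift ord0 j) = x 0 (widen_ord (leqnSn k) j).
Proof.
rewrite mxE (bigD1 (widen_ord (leqnSn k) j))//= !mxE /= eqxx mulr1.
rewrite big1 ?addr0// => i.
rewrite mxE /= /bump add1n eqSS => /negbTE ij.
by rewrite eq_sym [_ == _]ij mulr0.
Qed.

Lemma trshift_max y : (y *m shift_mx^T) 0 ord_max = 0.
Proof.
by rewrite mxE big1// => i _; rewrite !mxE /= ltn_eqF ?mulr0// ltn_ord.
Qed.

Lemma trshiftS y j :
  (y *m shift_mx^T) 0 (widen_ord (leqnSn k) j) = y 0 (lift ord0 j).
Proof.
rewrite mxE (bigD1 (lift ord0 j))//= !mxE /= eqxx mulr1 big1 ?addr0// => i ij.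
rewrite !mxE /= -[j.+1]/(nat_of_ord (lift ord0 j)).
by rewrite (negbTE (_ : _ != _)) ?mulr0.
Qed.

Lemma shift_norm x : dot (x *m shift_mx) (x *m shift_mx) <= dot x x.
Proof.
rewrite !dotE big_ord_recl shift0 mul0r add0r big_ord_recr /=.
under eq_bigr do rewrite shiftS.
by rewrite lerDl -expr2 sqr_ge0.
Qed.

Lemma trshift_norm y : dot (y *m shift_mx^T) (y *m shift_mx^T) <= dot y y.
Proof.
rewrite !dotE big_ord_recr /= trshift_max mul0r addr0 big_ord_recl.
under eq_bigr do rewrite trshiftS.
by rewrite lerDr -expr2 sqr_ge0.
Qed.

Lemma shift_sum x :
  dot (x *m shift_mx) (const_mx 1) = dot x (const_mx 1) - x 0 ord_max.
Proof.
rewrite !dotE big_ord_recl shift0 mul0r add0r big_ord_recr /=.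
under eq_bigr do rewrite shiftS mxE.
by rewrite !mxE mulr1 addrK; apply: eq_bigr => i _; rewrite mxE.
Qed.

Lemma shift_ones :
  (const_mx 1 : 'rV[R]_k.+1) *m shift_mx = const_mx 1 - delta_mx 0 0.
Proof.
apply/rowP => j; case: (unliftP ord0 j) => [i|] ->.
  by rewrite shiftS !mxE /= subr0.
by rewrite shift0 !mxE subrr.
Qed.

Definition chain_mx p q : 'M[R]_k.+1 := p%:M - q *: shift_mx.

(** Boundary term of the chain: applied to [q * s], it stands for the fictitious coordinate of index
    -1 with value [s]. *)
Definition chain_vec q : 'rV[R]_k.+1 := - q *: delta_mx 0 0.

Lemma mul_chain p q x : x *m chain_mx p q = p *: x - q *: (x *m shift_mx).
Proof. by rewrite mulmxBr mul_mx_scalar -scalemxAr. Qed.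

Lemma mul_trchain p q y :
  y *m (chain_mx p q)^T = p *: y - q *: (y *m shift_mx^T).
Proof.
rewrite linearB /= linearZ /= tr_scalar_mx mulmxBr mul_mx_scalar.
by rewrite -scalemxAr.
Qed.

Lemma chain_mxB p q p' q' :
  chain_mx p q - chain_mx p' q' = chain_mx (p - p') (q - q').
Proof. by apply/matrixP => i j; rewrite !mxE mulrnBl; ring. Qed.

(** The shift and its transpose do not increase the norm, so [p] and [q] contribute at most their
    absolute values. *)
Lemma chain_bounded c p q : `|p| + `|q| <= c -> mx_bounded c (chain_mx p q).
Proof.
move=> pqc.
have bound (u w : 'rV[R]_k.+1) : dot w w <= dot u u ->
    dot (p *: u - q *: w) (p *: u - q *: w) <= c ^+ 2 * dot u u.
  move=> wu; have h : dot (p *: u - q *: w) (p *: u - q *: w)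
      <= (`|p| + `|q|) * (`|p| * dot u u + `|q| * dot w w).
    rewrite !dotE !mulr_sumr -big_split /= mulr_sumr; apply: ler_sum => i _.
    rewrite !mxE; move: (u 0 i) (w 0 i) => a b.
    (* The right side minus the left is [|p * q|] times [(a + b) ^+ 2] if [p] and [q] have the same
       sign, and times [(a - b) ^+ 2] otherwise. *)
    case: (ger0P p) => hp; case: (ger0P q) => hq.
    - have : 0 <= p * q * (a + b) ^+ 2
        by apply: mulr_ge0 (sqr_ge0 _); rewrite mulr_ge0.
      lra.
    - have : 0 <= p * (- q) * (a - b) ^+ 2
        by apply: mulr_ge0 (sqr_ge0 _); rewrite mulr_ge0//; lra.
      lra.
    - have : 0 <= (- p) * q * (a - b) ^+ 2
        by apply: mulr_ge0 (sqr_ge0 _); rewrite mulr_ge0//; lra.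
      lra.
    - have : 0 <= (- p) * (- q) * (a + b) ^+ 2
        by apply: mulr_ge0 (sqr_ge0 _); rewrite mulr_ge0//; lra.
      lra.
  apply: (le_trans h).
  have pq0 : 0 <= `|p| + `|q| by rewrite addr_ge0.
  apply: (@le_trans _ _ ((`|p| + `|q|) * ((`|p| + `|q|) * dot u u))).
    by rewrite ler_wpM2l// mulrDl lerD2l ler_wpM2l.
  rewrite mulrA -expr2 ler_wpM2r ?dot_ge0// ler_pXn2r ?nnegrE//.
  exact: le_trans pqc.
split=> [x|y]; first by rewrite mul_chain; apply/bound/shift_norm.
by rewrite mul_trchain; apply/bound/trshift_norm.
Qed.

Definition chain_fun p q s := bilin (chain_mx p q) (chain_vec (q * s)).

(** A constant vector equal to the boundary value has no increments along the chain. *)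
Lemma chain_fun_saddle a s y : chain_fun a a s (const_mx s) y = 0.
Proof.
have -> : const_mx s = s *: const_mx 1 :> 'rV[R]_k.+1.
  by rewrite scalemx_const mulr1.
rewrite /chain_fun /bilin mul_chain -scalemxAl shift_ones /chain_vec.
rewrite -!scalerBr opprB addrCA subrr addr0 scalerA scaleNr subrr.
exact: dot0l.
Qed.

Lemma dot_ones : dot (const_mx 1) (const_mx 1 : 'rV[R]_k.+1) = k.+1%:R.
Proof.
rewrite dotE; under eq_bigr do rewrite !mxE mulr1.
by rewrite sumr_const card_ord.
Qed.

(** Against a constant [y] the increments telescope to the last coordinate minus [s]. *)
Lemma chain_fun_ones a s t x :
  chain_fun a a s x (- t *: const_mx 1) = a * t * (s - x 0 ord_max).
Proof.
rewrite /chain_fun /bilin dotZr mul_chain -scaleNr !dotDl !dotZl shift_sum.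
rewrite dot_delta mxE; ring.
Qed.

Section Gap.
Variables (a r : R).
Let s := 2 * r / Num.sqrt k.+1%:R.
Let X := eball (const_mx (s / 2) : 'rV[R]_k.+1) r.
Let Y := eball (0 : 'rV[R]_k.+1) r.

Let saddle_in : X (const_mx s).
Proof.
rewrite /X /eball /=.
have -> : const_mx s - const_mx (s / 2) = (s / 2) *: const_mx 1 :> 'rV[R]_k.+1.
  by apply/rowP => j; rewrite !mxE; lra.
(* The choice of [s] puts this point exactly on the boundary of the ball. *)
have -> : s / 2 = r / Num.sqrt k.+1%:R by rewrite /s mulrAC (mulrC 2) mulfK.
by rewrite dotZl dotZr dot_ones mulrA -expr2 exprMn exprVn sqr_sqrtr// divfK.
Qed.

Lemma chain_gap_ge0 x y : 0 <= gap X Y (chain_fun a a s) x y.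
Proof.
have Y0 : Y 0 by rewrite /Y /eball /= subrr dot0l sqr_ge0.
apply: le_trans (gap_eball_ge _ _ _ _ saddle_in Y0).
by rewrite [X in _ - X]chain_fun_saddle subr0 /bilin dot0r.
Qed.

Lemma chain_gap_ge x y : x 0 ord_max = 0 ->
  2 * a * r ^+ 2 / k.+1%:R <= gap X Y (chain_fun a a s) x y.
Proof.
move=> x0; pose t := r / Num.sqrt k.+1%:R.
have sK : Num.sqrt k.+1%:R ^+ 2 = k.+1%:R :> R by rewrite sqr_sqrtr.
have sK0 : Num.sqrt k.+1%:R != 0 :> R by rewrite gt_eqF// sqrtr_gt0.
have Yt : Y (- t *: const_mx 1).
  rewrite /Y /eball /= subr0 dotZl dotZr dot_ones mulrA mulrNN -expr2.
  by rewrite /t exprMn exprVn sK divfK.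
apply: le_trans (gap_eball_ge _ _ _ _ saddle_in Yt).
rewrite [X in _ - X]chain_fun_saddle subr0 [leRHS]chain_fun_ones x0 subr0 /t /s.
by rewrite -[X in _ / X <= _]sK le_eqVlt; apply/orP; left; apply/eqP; field.
Qed.

End Gap.
End Chain.

(** * Splitting the chain among nodes by parity *)

Section Nodes.
Context {R : realType} {k m : nat}.
Variables (a s : R).
Hypothesis a_ge0 : 0 <= a.
Hypothesis m_ge2 : (2 <= m)%N.

Let class_size (b : bool) := if b then m.+1./2 else uphalf m.+1.

Let sum_class (b : bool) :
  \sum_(i < m.+1) ((odd i == b)%:R : R) = (class_size b)%:R.
Proof.
rewrite -natr_sum; congr (_%:R); rewrite /class_size.
elim: m.+1 => [|n IHn]; first by rewrite big_ord0; case: b.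
by rewrite big_ord_recr /= IHn {IHn}; case: b => /=; rewrite ?uphalfE; lia.
Qed.

Let class_size_gt0 b : (0 < class_size b)%N.
Proof. by rewrite /class_size; case: b; lia. Qed.

(* The denominator is the number of nodes of parity b. *)
Definition weight (b : bool) (i : 'I_m.+1) : R :=
  (odd i == b)%:R * (a * (m.+1%:R / (if b then m.+1./2 else uphalf m.+1)%:R)).

Lemma weight_avg b : m.+1%:R^-1 * \sum_i weight b i = a.
Proof.
rewrite -mulr_suml sum_class -/(class_size b).
have c0 : (class_size b)%:R != 0 :> R by rewrite pnatr_eq0 -lt0n.
have n0 : m.+1%:R != 0 :> R by rewrite pnatr_eq0.
move: (class_size b)%:R m.+1%:R c0 n0 => c n c0 n0; field; exact/andP.
Qed.

Lemma weight_neq b (i : 'I_m.+1) : odd i != b -> weight b i = 0.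
Proof. by move=> /negbTE ib; rewrite /weight ib mul0r. Qed.

(** With at least three nodes, each parity class contains at least a third of them; three nodes,
    only one of them odd, is the extreme case. Hence the factor 3. *)
Lemma weight_bounds b (i : 'I_m.+1) : odd i = b -> a <= weight b i <= 3 * a.
Proof.
move=> ib; rewrite /weight ib eqxx mul1r -/(class_size b).
have c0 : 0 < (class_size b)%:R :> R by rewrite ltr0n class_size_gt0.
rewrite [3 * a]mulrC ler_peMr//=; last first.
  by rewrite ler_pdivlMr// mul1r ler_nat /class_size; case: b {ib c0}; lia.
rewrite ler_wpM2l// ler_pdivrMr// -natrM ler_nat /class_size.
by case: b {ib c0}; lia.
Qed.

Definition node_fun (i : 'I_m.+1) : 'rV[R]_k.+1 -> 'rV[R]_k.+1 -> R :=
  chain_fun (weight false i) (weight true i) s.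

Lemma average_node : average node_fun = chain_fun a a s.
Proof.
have avgM b c : m.+1%:R^-1 * \sum_i (weight b i * c) = a * c.
  by rewrite -(mulr_suml _ _ (weight b) c) mulrA weight_avg.
rewrite [LHS]average_bilin; congr bilin; apply/matrixP => u v.
  rewrite !mxE summxE; under eq_bigr do rewrite !mxE -[weight _ _ *+ _]mulr_natr.
  by rewrite sumrB mulrBr !avgM mulr_natr.
by rewrite -scaler_suml sumrN !mxE mulrA mulrN avgM.
Qed.

Lemma node_smooth L i : 3 * a <= L -> smooth L (node_fun i).
Proof.
move=> aL; have L0 : 0 <= L by rewrite (le_trans _ aL)// mulr_ge0.
apply: (smooth_bilin _ L0); apply: chain_bounded; apply: le_trans aL.
case Hi : (odd i).
  rewrite weight_neq ?Hi// normr0 add0r.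
  by have /andP[h1 h2] := weight_bounds Hi; rewrite ger0_norm// (le_trans _ h1).
rewrite [weight true i]weight_neq ?Hi// normr0 addr0.
by have /andP[h1 h2] := weight_bounds Hi; rewrite ger0_norm// (le_trans _ h1).
Qed.

(** The difference with the average is again a chain matrix. If [w] is the nonzero weight of the
    node, its coefficients are [w - a] and [- a] in some order, of absolute sum [w <= 3 * a]. *)
Lemma node_similar : second_order_similar (3 * a) node_fun.
Proof.
split=> [i|i z]; first exact: twice_differentiable_bilin.
rewrite average_node !hess_bilin opp_block_mx add_block_mx !subr0.
rewrite -linearB /= chain_mxB.
apply: spectral_norm_block; first by rewrite mulr_ge0.
apply: chain_bounded; case Hi : (odd i).
  have /andP[h1 h2] := weight_bounds Hi.
  rewrite weight_neq ?Hi// sub0r normrN (ger0_norm a_ge0) ger0_norm ?subr_ge0//.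
  lra.
have /andP[h1 h2] := weight_bounds Hi.
rewrite [weight true i]weight_neq ?Hi// sub0r normrN (ger0_norm a_ge0).
rewrite ger0_norm ?subr_ge0//; lra.
Qed.

End Nodes.

(** * Coordinates ordered by discovery *)

Section Level.
Context {R : realType}.

(* The coordinates are discovered in the order y_0, x_0, y_1, x_1, ...: y_j has
   rank 2j and x_j rank 2j+1, and a vector has level l if its coordinates of
   rank at least l vanish. *)
Definition level d (o l : nat) : set 'rV[R]_d :=
  [set v | forall j : 'I_d, (l <= j.*2 + o)%N -> v 0 j = 0].

Lemma level_le d o l l' : (l <= l')%N -> level (d := d) o l `<=` level o l'.
Proof. by move=> ll' v vl j /(leq_trans ll')/vl. Qed.

(** Levels are linear subspaces. *)
Lemma level_span d o l (s : seq 'rV[R]_d) v :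
  {in s, forall u, level o l u} -> v \in << s >>%VS -> level o l v.
Proof.
move=> sl /(coord_span (X := in_tuple s)) -> j lj.
rewrite summxE big1// => i _; rewrite mxE (sl _ _ j lj) ?mulr0//.
by rewrite mem_nth.
Qed.

End Level.

(** * Progress of the memories, round by round *)

Section Progress.
Context {R : realType} {k m : nat}.
Variable f : 'I_m.+1 -> 'rV[R]_k -> 'rV[R]_k -> R.

(* Node i, left alone, cannot leave a level of the same parity as i. *)
Hypothesis grad_level : forall (i : 'I_m.+1) l x y, odd l = odd i ->
  level 1 l x -> level 0 l y -> level 1 l (gradx (f i) x y) /\
                                level 0 l (grady (f i) x y).

Definition bounded_by (l : 'I_m.+1 -> nat) (M : @memory R k k m) : Prop :=
  forall i, memx M i `<=` level 1 (l i) /\ memy M i `<=` level 0 (l i).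

(* After t rounds, node i may have passed level t by its own computations only
   if i and t have different parities; it is then stuck at level t + 1. *)
Definition reach (t : nat) (i : 'I_m.+1) : nat := (t + (odd i (+) odd t))%N.

Lemma reach_le t i : (reach t i <= t.+1)%N.
Proof. by rewrite -addn1 leq_add2l leq_b1. Qed.

Lemma grows_sub T (adm M M' L : set T) :
  grows adm M M' -> M `<=` L -> adm `<=` L -> M' `<=` L.
Proof. by move=> [_ M'sub] ML aL v /M'sub[/ML|/aL]. Qed.

Lemma local_step_bounded t M M' : local_step f M M' ->
  bounded_by (reach t) M -> bounded_by (reach t) M'.
Proof.
move=> [i [gx gy un]] Mt j; have [->|ji] := eqVneq j i; last first.
  by have [-> ->] := un j ji; exact: Mt.
(* The level [reach t i] has the parity of [i], so gradients at node [i] stay within it. *)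
have odd_reach : odd (reach t i) = odd i.
  by rewrite /reach oddD oddb addbC -addbA addbb addbF.
have [Mx My] := Mt i; split.
  apply: (grows_sub gx Mx) => v [x1 [x2 [y2 [h1 h2 h3]]]].
  have [hg _] := grad_level odd_reach (Mx _ h2) (My _ h3).
  by apply: level_span => u; rewrite !inE => /orP[]/eqP->; first exact: Mx.
apply: (grows_sub gy My) => v [x1 [x2 [y2 [h1 h2 h3]]]].
have [_ hg] := grad_level odd_reach (Mx _ h2) (My _ h3).
by apply: level_span => u; rewrite !inE => /orP[]/eqP->; first exact: My.
Qed.

Lemma local_computation_bounded t M M' : local_computation f M M' ->
  bounded_by (reach t) M -> bounded_by (reach t) M'.
Proof.
by elim=> [? ? /local_step_bounded|//|? ? ? _ IH1 _ IH2 /IH1/IH2]; exact.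
Qed.

Lemma server_adm_level d o l S (M : 'I_m.+1 -> set 'rV[R]_d) :
  (forall i, M i `<=` level o l) -> server_adm S M `<=` level o l.
Proof.
move=> Ml v [xs [Mxs]]; apply: level_span => u.
by rewrite inE => /orP[/eqP->|/mapP[i _ ->]]; exact: (Ml _ _ (Mxs _)).
Qed.

Lemma client_adm_level d o l i (M : 'I_m.+1 -> set 'rV[R]_d) :
  (forall i, M i `<=` level o l) -> client_adm i M `<=` level o l.
Proof.
move=> Ml v [x1 [xi [M1 Mi]]]; apply: level_span => u.
by rewrite !inE => /orP[]/eqP->; [exact: Ml M1|exact: Ml Mi].
Qed.

(** One level common to all nodes is used because a message may carry a point of any sampled
    node. *)
Lemma comm_step_bounded l dir S (M M' : memory) : comm_step dir S M M' ->
  bounded_by (fun=> l) M -> bounded_by (fun=> l) M'.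
Proof.
move=> st Ml; have Mx i := (Ml i).1; have My i := (Ml i).2.
case: dir st => [[gx gy un] i|st i].
  have [->|i0] := eqVneq i ord0; last by have [-> ->] := un i i0.
  by split; [apply: (grows_sub gx)|apply: (grows_sub gy)] => //;
    exact: server_adm_level.
have := st i; case: ifP => _ [] => [gx gy|-> -> //].
by split; [apply: (grows_sub gx)|apply: (grows_sub gy)] => //;
  exact: client_adm_level.
Qed.

(** Induction on the rounds. After [t] rounds every node is within level [t + 1]; communication
    preserves this common level, which is at most [reach (t + 1) i], and local computations stay
    within the latter. *)
Lemma dfo_bounded Seed (A : algorithm Seed) u h : dfo f A ->
  (forall t, (t < size h)%N -> exists dir,
     alg_next A u (take t h) = Some (dir, #|nth finset.set0 h t|)) ->
  bounded_by (reach (size h)) (alg_mem A u h).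
Proof.
move=> [init step _]; elim/last_ind: h => [_|h S IH hS].
  by apply: (local_computation_bounded (init u)) => i; split=> _ -> j _;
    rewrite mxE.
have /hS[dir] : (size h < size (rcons h S))%N by rewrite size_rcons.
rewrite -cats1 take_size_cat// cats1 nth_rcons ltnn eqxx => next.
have [M cs lc] := step _ _ _ _ next.
apply: (local_computation_bounded lc) => i.
have /(_ i)[] : bounded_by (fun=> (size h).+1) M.
  apply: (comm_step_bounded cs) => j.
  have /(_ j)[hx hy] : bounded_by (reach (size h)) (alg_mem A u h).
    apply: IH => t th; have := hS t; rewrite size_rcons nth_rcons th.
    by rewrite -cats1 takel_cat ?(ltnW th)// => /(_ (ltnW th)).
  have hj := reach_le (size h) j.
  by split=> v; [move=> /hx|move=> /hy]; exact: level_le.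
have hi : ((size h).+1 <= reach (size (rcons h S)) i)%N.
  by rewrite size_rcons leq_addr.
by move=> hx hy; split=> v; [move=> /hx|move=> /hy]; exact: level_le.
Qed.

End Progress.

(** * Parity of the links of the chain *)

Section ChainProgress.
Context {R : realType} {k m : nat}.
Variables (a s : R).

(** An odd node links [y_j] with [x_(j-1)], of ranks 2j and 2j-1, which no odd level separates. An
    even node links [y_j] with [x_j], of ranks 2j and 2j+1, which no even level separates. *)
Lemma node_grad_level (i : 'I_m.+1) l (x y : 'rV[R]_k.+1) : odd l = odd i ->
  level 1 l x -> level 0 l y ->
  level 1 l (gradx (node_fun a s i) x y) /\
  level 0 l (grady (node_fun a s i) x y).
Proof.
move=> li xl yl; rewrite gradx_bilin grady_bilin mul_trchain mul_chain /chain_vec.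
case Hi : (odd i); rewrite Hi in li.
  rewrite [weight _ false i]weight_neq ?Hi// !scale0r !sub0r.
  set q := weight _ _ _; split=> j lj.
    have [->|jm] := eqVneq j ord_max.
      by rewrite -scaleNr mxE trshift_max mulr0.
    have jk : (j < k)%N by rewrite ltn_neqAle jm -ltnS ltn_ord.
    have jE : j = widen_ord (leqnSn k) (Ordinal jk) by exact: val_inj.
    rewrite -scaleNr mxE jE trshiftS yl ?mulr0//= /bump /=; lia.
  rewrite -scaleNr mxE [X in X + _]mxE [X in _ + X]mxE.
  (* Coordinate 0 receives the boundary term, but its rank 0 is below the odd level [l]. *)
  case: (unliftP ord0 j) lj => [j'|] -> lj; last by case: l li lj {xl yl}.
  rewrite shiftS xl ?mulr0 ?add0r ?mxE /= ?mulr0 //.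
  by move: lj; rewrite /= /bump /=; lia.
rewrite [weight _ true i]weight_neq ?Hi// mul0r oppr0 !scale0r !subr0 addr0.
split=> j lj; rewrite mxE; first by rewrite yl ?mulr0//; lia.
by rewrite xl ?mulr0//; lia.
Qed.

End ChainProgress.

(** * Expected gap against expected number of rounds *)

Lemma expectation_tradeoff (R : realType) d (Omega : measurableType d)
    (P : probability Omega R) (G : Omega -> R) (N : Omega -> nat) (b c e : R) :
  P.-integrable [set: Omega] (EFin \o G) -> measurable_fun [set: Omega] N ->
  (forall w, 0 <= G w) -> 0 < c -> (forall w, b <= G w + c * (N w)%:R) ->
  ('E_P[G] <= e%:E)%E -> (((b - e) / c)%:E <= 'E_P[fun w => (N w)%:R])%E.
Proof.
move=> Gi mN G0 c0 bGN Ge.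
have mG := measurable_int P Gi.
have mNR : measurable_fun [set: Omega]
    (fun w => ((N w)%:R : R)%:E : \bar R).
  apply/measurable_EFinP.
  exact: (@measurableT_comp _ _ _ _ _ _ (fun n : nat => n%:R : R)).
have mcN : measurable_fun [set: Omega]
    (fun w => (c%:E * ((N w)%:R : R)%:E)%E : \bar R).
  exact: measurable_funeM.
rewrite mulrC EFinM lee_pdivrMl// EFinB leeBlDl//.
have b_le : (b%:E <= \int[P]_w ((G w)%:E + c%:E * ((N w)%:R)%:E))%E.
  have -> : b%:E = (\int[P]_w b%:E)%E.
    by rewrite integral_cst//= probability_setT mule1.
  (* Monotonicity is applied to nonnegative integrands, so a negative [b] is first compared with
     0. *)
  have [b0|b0] := lerP 0 b; last first.
    apply: (@le_trans _ _ 0%E).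
      by rewrite integral_cst//= probability_setT mule1 lee_fin ltW.
    apply: integral_ge0 => w _.
    by rewrite -EFinM -EFinD lee_fin addr_ge0// mulr_ge0// ltW.
  apply: ge0_le_integral => //.
  - by apply: emeasurable_funD.
  - by move=> w _; rewrite -EFinM -EFinD lee_fin.
apply: (le_trans b_le); rewrite ge0_integralD//; last 2 first.
- by move=> w _; rewrite lee_fin.
- by move=> w _; rewrite mule_ge0// lee_fin ltW.
rewrite ge0_integralZl//; last by rewrite lee_fin ltW.
by move: Ge; rewrite unlock => Ge; rewrite leeD2r.
Qed.

(** * Choice of the parameters and the lower bound *)

Theorem theorem3 (R : realType) :
  exists c0 : R, 0 < c0 /\
  forall (delta L D eps : R) (m : nat),
    0 < delta -> delta <= L -> (3 <= m.+1)%N -> 0 < D ->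
    0 < eps -> eps <= delta * D ^+ 2 / (12 * Num.sqrt 2) ->
  exists (dx dy : nat) (f : 'I_m.+1 -> 'rV[R]_dx -> 'rV[R]_dy -> R)
         (X : set 'rV[R]_dx) (Y : set 'rV[R]_dy),
    [/\ forall i, smooth L (f i),
        forall i, convex_concave (f i)
      & second_order_similar delta f] /\
    [/\ X `*` Y !=set0, closed (X `*` Y),
        @convex_set R ('rV[R]_dx * 'rV[R]_dy)%type (X `*` Y)
      & diameter_le D (X `*` Y)] /\
    forall (dS dO : measure_display) (Seed : measurableType dS)
           (Omega : measurableType dO) (P : probability Omega R)
           (A : algorithm Seed) (U : Omega -> Seed)
           (batch : nat -> Omega -> {set 'I_m.+1}) (N : Omega -> nat),
      dfo f A -> execution P A U batch N ->
      let G := fun w => let z := output A U batch N w in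
                        gap X Y (average f) z.1 z.2 in
      P.-integrable [set: Omega] (EFin \o G) ->
      ('E_P[G] <= eps%:E)%E ->
      ((c0 * (delta * D ^+ 2 / eps))%:E <= 'E_P[fun w => (N w)%:R])%E.
Proof.
(* The estimates at the end, with [7 / 5 <= q] and [tau <= 2 * k.+1%:R], would allow [120^-1]. *)
exists (200^-1); split; first by rewrite invr_gt0.
move=> delta L D eps m delta_gt0 deltaL m_ge D_gt0 eps_gt0 eps_le.
set q := Num.sqrt 2 in eps_le.
have q2 : q * q = 2 by rewrite -expr2 sqr_sqrtr.
have q0 : 0 < q by rewrite sqrtr_gt0.
have q_ge : 7 / 5 <= q.
  by rewrite -(@ler_pXn2r _ 2) ?nnegrE ?(ltW q0)// [leRHS]expr2 q2; lra.
pose tau := delta * D ^+ 2 / (12 * q * eps).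
have tau_ge1 : 1 <= tau.
  rewrite ler_pdivlMr ?mulr_gt0// mul1r.
  by move: eps_le; rewrite ler_pdivlMr ?mulr_gt0// mulrC.
have /andP[K_le K_gt] := truncn_itv (le_trans ler01 tau_ge1).
have K_gt0 : (0 < Num.truncn tau)%N.
  by rewrite -ltnS -(ltr_nat R) (le_lt_trans tau_ge1).
(* The upper bound on [eps] gives [1 <= tau], so the chain length has the form [k.+1] and a last
   coordinate exists. *)
case EK : (Num.truncn tau) K_gt0 K_le K_gt => [//|k] _ K_le K_gt.
pose a := delta / 3; pose r := D / (2 * q).
have a3 : 3 * a = delta by rewrite /a; lra.
have a_ge0 : 0 <= a by rewrite divr_ge0// ltW.
have r2 : 8 * r ^+ 2 = D ^+ 2.
  have -> : r ^+ 2 = D ^+ 2 / (4 * (q * q)).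
    by rewrite /r; field; exact: lt0r_neq0.
  by rewrite q2; field.
pose s := 2 * r / Num.sqrt k.+1%:R.
pose f := @node_fun R k m a s.
exists k.+1, k.+1, f, (eball (const_mx (s / 2)) r), (eball 0 r).
split; first split.
- by move=> i; apply: node_smooth; rewrite ?a3.
- by move=> i; exact: convex_concave_bilin.
- by rewrite -a3; exact: node_similar.
split; first split.
- by exists (const_mx (s / 2), 0); split; rewrite /eball /= subrr dot0l sqr_ge0.
- exact: closed_eballX.
- exact: convex_eballX.
- by apply: diameter_eballX; rewrite ?r2// ltW.
move=> dS dO Seed Omega P A U batch N A_dfo [[_ mN _ _] next_some next_none _].
move=> G Gi Ge.
have avg_f : average f = chain_fun a a s by exact: average_node.
have G_ge0 w : 0 <= G w by rewrite /G avg_f; exact: chain_gap_ge0.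
have G_ge w : (N w < k.+1)%N -> q * eps <= G w.
  move=> Nk; have [_ _ A_out] := A_dfo.
  have [outx _] := A_out _ _ (next_none w).
  have := @dfo_bounded _ _ _ _ (@node_grad_level _ _ _ a s) _ _ (U w)
    (history batch (N w) w) A_dfo.
  rewrite size_mkseq; case/(_ _ ord0) => [t tN|memx_level _].
    have [dir next] := next_some w t tN; exists dir.
    rewrite nth_mkseq// /history /mkseq -map_take take_iota.
    by rewrite (minn_idPl (ltnW tN)).
  have xlast : (output A U batch N w).1 0 ord_max = 0.
    (* The last [x] coordinate has rank 2k+1, while the server is within level
       [N w + 1 <= k + 1]. *)
    apply: memx_level outx _ _; apply: leq_trans (reach_le _ _) _.
    by rewrite addn1 ltnS -addnn (leq_trans _ (leq_addr k k)).
  rewrite /G avg_f; apply: le_trans (chain_gap_ge a r _ xlast).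
  have -> : 2 * a * r ^+ 2 = delta * D ^+ 2 / 12 by rewrite -r2 /a; field.
  move: K_le; rewrite /tau !ler_pdivlMr ?mulr_gt0//; lra.
have c_gt0 : 0 < q * eps / k.+1%:R by rewrite divr_gt0// mulr_gt0.
apply: (le_trans _ (expectation_tradeoff (b := q * eps) Gi mN G_ge0 c_gt0 _ Ge)).
  have q_neq0 : q != 0 by exact: lt0r_neq0.
  have eps_neq0 : eps != 0 by exact: lt0r_neq0.
  have k_neq0 : k.+1%:R != 0 :> R by rewrite pnatr_eq0.
  rewrite lee_fin.
  have -> : (q * eps - eps) / (q * eps / k.+1%:R) = k.+1%:R * (q - 1) / q.
    by move: k.+1%:R k_neq0 => K K_neq0; field; rewrite q_neq0 K_neq0 eps_neq0.
  have -> : delta * D ^+ 2 / eps = 12 * q * tau.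
    by rewrite /tau; field; rewrite q_neq0 eps_neq0.
  rewrite ler_pdivlMr//.
  have -> : 200^-1 * (12 * q * tau) * q = 24 / 200 * tau.
    by transitivity (12 / 200 * (q * q) * tau); [field|rewrite q2; lra].
  (* Truncation loses at most a factor 2, since the chain length is at least 1. *)
  have tau_le : tau <= 2 * k.+1%:R.
    rewrite (le_trans (ltW K_gt))// -natrM ler_nat.
    by rewrite mul2n -addnn addSn !ltnS leq_addl.
  have : k.+1%:R * (2 / 5) <= k.+1%:R * (q - 1) :> R by rewrite ler_pM2l//; lra.
  lra.
(* With few rounds the gap alone reaches [q * eps]; otherwise the term in [N w] does. *)
move=> w; case: (ltnP (N w) k.+1) => [/G_ge GN|KN].
  by rewrite (le_trans GN)// lerDl (mulr_ge0 (ltW c_gt0)).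
apply: (@le_trans _ _ (q * eps / k.+1%:R * (N w)%:R)); last by rewrite lerDr.
by rewrite mulrAC ler_pdivlMr// ler_pM2l ?ler_nat// mulr_gt0.
Qed.
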